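(* The system $\textsf{M}$ proves: every type two functional restricted to Cantor space which maps standard binary sequences to standard numbers, is standard. That is, for every $\varphi^2$ such that $\varphi(f)$ is standard for every standard binary sequence $f^1$, the functional $\varphi(\mathfrak{b}(\cdot))^2$ is standard.
   Context: $\mathfrak{b}^{1\to1}$ is defined by $\mathfrak{b}(f)(k)=0$ if $f(k)=0$ and $\mathfrak{b}(f)(k)=1$ otherwise; $\varphi(\mathfrak{b}(\cdot))$ is called the restriction of $\varphi^2$ to Cantor space. A binary sequence is an $f^1$ with $f(n)\le1$ for all $n$. Type $0$ is the type of natural numbers, $1$ is $0\to0$, $2$ is $1\to0$; superscripts denote types. $\textsf{E-PA}^{\omega}$ is classical Peano arithmetic in all finite types with the axiom of extensionality. Strong majorizability $\le^*$: $x\le^*_0y$ is $x\le_0y$, and $x\le^*_{\rho\to\sigma}y$ is $(\forall v)(\forall u\le^*_\rho v)(xu\le^*_\sigma yv\wedge yu\le^*_\sigma yv)$. An object $x$ is monotone if $x\le^*x$; $\tilde\forall,\tilde\exists$ denote quantifiers over monotone objects. The language of $\textsf{E-PA}^{\omega}_{\mathrm{st}}$ adds a predicate $\mathrm{st}^\sigma$ (``is standard'') for each finite type $\sigma$. A formula is internal if it does not involve $\mathrm{st}$. $(\forall^{\mathrm{st}}x)\Phi$ is $(\forall x)(\mathrm{st}(x)\to\Phi)$ and $(\exists^{\mathrm{st}}x)\Phi$ is $(\exists x)(\mathrm{st}(x)\wedge\Phi)$. $\textsf{E-PA}^{\omega}_{\mathrm{st}}$ is $\textsf{E-PA}^{\omega}$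 plus: (1) $x=_\sigma y\to(\mathrm{st}(x)\to\mathrm{st}(y))$; (2) $\mathrm{st}(y)\to(x\le^*_\sigma y\to\mathrm{st}(x))$; (3) $\mathrm{st}(t)$ for each closed term $t$; (4) $\mathrm{st}(z^{\sigma\to\tau})\to(\mathrm{st}(x^\sigma)\to\mathrm{st}(zx))$; and external induction $\Phi(0)\wedge(\forall^{\mathrm{st}}n^0)(\Phi(n)\to\Phi(n+1))\to(\forall^{\mathrm{st}}n^0)\Phi(n)$ for any $\Phi$. $\textsf{M}$ is $\textsf{E-PA}^{\omega}_{\mathrm{st}}$ plus, for internal $\varphi$: monotone choice $\textsf{mAC}^\omega_{\mathrm{st}}$: $(\tilde\forall^{\mathrm{st}}x)(\tilde\exists^{\mathrm{st}}y)\varphi(x,y)\to(\tilde\exists^{\mathrm{st}}f)(\tilde\forall^{\mathrm{st}}x)(\exists y\le^*f(x))\varphi(x,y)$; realization $\textsf{R}^\omega$: $(\forall x)(\exists^{\mathrm{st}}y)\varphi(x,y)\to(\tilde\exists^{\mathrm{st}}z)(\forall x)(\exists y\le^*z)\varphi(x,y)$; and $\textsf{MAJ}^\omega_{\mathrm{st}}$: $(\forall^{\mathrm{st}}x)(\exists^{\mathrm{st}}y)(x\le^*y)$. *)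

(* Defs.v *)
From Stdlib Require Import List.
Import ListNotations.
Set Implicit Arguments.
Unset Strict Implicit.

Declare Scope obj_scope.
Delimit Scope obj_scope with obj.
Open Scope obj_scope.

(** * Finite types, terms, formulas

    Intrinsically typed de Bruijn syntax: [tm G s] and [fm G] are the terms of
    type [s] and the formulas whose free variables are among [G]. *)

Inductive ty : Type :=
| O : ty
| Arr : ty -> ty -> ty.

Notation "s ⇒ t" := (Arr s t) (at level 55, right associativity) : obj_scope.

Definition ty1 : ty := O ⇒ O.
Definition ty2 : ty := ty1 ⇒ O.

Definition ctx : Type := list ty.

Inductive var : ctx -> ty -> Type :=
| vz : forall G s, var (s :: G) s
| vs : forall G s t, var G s -> var (t :: G) s.

Arguments vz {G s}.
Arguments vs {G s t} _.

Inductive tm (G : ctx) : ty -> Type :=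
| Var : forall s, var G s -> tm G s
| App : forall s t, tm G (s ⇒ t) -> tm G s -> tm G t
| Zero : tm G O
| Succ : tm G (O ⇒ O)
| Pi : forall s t, tm G (s ⇒ t ⇒ s)
| Sigma : forall r s t, tm G ((r ⇒ s ⇒ t) ⇒ (r ⇒ s) ⇒ r ⇒ t)
| Rec : forall s, tm G (O ⇒ s ⇒ (s ⇒ O ⇒ s) ⇒ s).

Arguments Var {G s} _.
Arguments App {G s t} _ _.
Arguments Zero {G}.
Arguments Succ {G}.
Arguments Pi {G s t}.
Arguments Sigma {G r s t}.
Arguments Rec {G s}.

Notation "x · y" := (App x y) (at level 40, left associativity) : obj_scope.

(** Equality at type [O] is the only primitive equality. *)
Inductive fm (G : ctx) : Type :=
| Eq0 : tm G O -> tm G O -> fm G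
| St : forall s, tm G s -> fm G
| Bot : fm G
| Imp : fm G -> fm G -> fm G
| And : fm G -> fm G -> fm G
| Or : fm G -> fm G -> fm G
| All : forall s, fm (s :: G) -> fm G
| Ex : forall s, fm (s :: G) -> fm G.

Arguments Eq0 {G} _ _.
Arguments St {G s} _.
Arguments Bot {G}.
Arguments Imp {G} _ _.
Arguments And {G} _ _.
Arguments Or {G} _ _.
Arguments All {G} s _.
Arguments Ex {G} s _.

Notation "A ⊃ B" := (Imp A B) (at level 75, right associativity) : obj_scope.
Notation "A ∧∧ B" := (And A B) (at level 70, right associativity) : obj_scope.

Definition Neg G (A : fm G) : fm G := A ⊃ Bot.

Fixpoint closed G s (t : tm G s) : Prop :=
  match t with
  | Var _ => False
  | App f a => closed f /\ closed a
  | _ => True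
  end.

Fixpoint internal G (A : fm G) : Prop :=
  match A with
  | Eq0 _ _ | Bot => True
  | St _ => False
  | Imp B C | And B C | Or B C => internal B /\ internal C
  | All _ B | Ex _ B => internal B
  end.

(** * Simultaneous substitution *)

Definition sub (G D : ctx) : Type := forall s, var G s -> tm D s.

Fixpoint tsub G D (f : sub G D) s (t : tm G s) : tm D s :=
  match t with
  | Var v => f _ v
  | App a b => tsub f a · tsub f b
  | Zero => Zero
  | Succ => Succ
  | Pi => Pi
  | Sigma => Sigma
  | Rec => Rec
  end.

Definition idsub G : sub G G := fun _ v => Var v.

Definition shift G s : sub G (s :: G) := fun _ v => Var (vs v).

Definition wk G s t (x : tm G t) : tm (s :: G) t := tsub (@shift G s) x.

Definition scons G D s (x : tm D s) (f : sub G D) : sub (s :: G) D :=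
  fun t v =>
    match v in var G' t' return
      match G' with
      | [] => unit
      | s' :: G0 => tm D s' -> sub G0 D -> tm D t'
      end
    with
    | vz => fun x _ => x
    | vs v' => fun _ f => f _ v'
    end x f.

Definition up G D s (f : sub G D) : sub (s :: G) (s :: D) :=
  scons (Var vz) (fun t v => wk s (f t v)).

Fixpoint fsub G D (f : sub G D) (A : fm G) : fm D :=
  match A with
  | Eq0 x y => Eq0 (tsub f x) (tsub f y)
  | St x => St (tsub f x)
  | Bot => Bot
  | Imp B C => fsub f B ⊃ fsub f C
  | And B C => fsub f B ∧∧ fsub f C
  | Or B C => Or (fsub f B) (fsub f C)
  | All s B => All s (fsub (up f) B)
  | Ex s B => Ex s (fsub (up f) B)
  end.

Definition fwk G s (A : fm G) : fm (s :: G) := fsub (@shift G s) A.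

Definition inst G s (A : fm (s :: G)) (x : tm G s) : fm G :=
  fsub (scons x (@idsub G)) A.

(** * Closed terms via bracket abstraction *)

Definition lam_var G s t (v : var (s :: G) t) : tm G (s ⇒ t) :=
  match v in var G' t' return
    match G' with
    | [] => unit
    | s' :: G0 => tm G0 (s' ⇒ t')
    end
  with
  | @vz _ s => @Sigma _ s (s ⇒ s) s · Pi · Pi
  | vs v' => Pi · Var v'
  end.

Fixpoint lam G s t (x : tm (s :: G) t) : tm G (s ⇒ t) :=
  match x with
  | Var v => lam_var v
  | App a b => Sigma · lam a · lam b
  | Zero => Pi · Zero
  | Succ => Pi · Succ
  | Pi => Pi · Pi
  | Sigma => Pi · Sigma
  | Rec => Pi · Rec
  end.

Notation v0 := (Var vz).
Notation v1 := (Var (vs vz)).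
Notation v2 := (Var (vs (vs vz))).

Definition One G : tm G O := Succ · Zero.
Arguments One {G}.

(** [plus · x · y] recurses on [y]. *)
Definition plus G : tm G (O ⇒ O ⇒ O) :=
  lam (lam (Rec · v0 · v1 · lam (lam (Succ · v1)))).
Arguments plus {G}.

(** The functional 𝔟: [λf. λk.] [0] if [f k = 0], and [1] otherwise. *)
Definition bb G : tm G (ty1 ⇒ ty1) :=
  lam (lam (Rec · (v1 · v0) · Zero · lam (lam One))).
Arguments bb {G}.

(** [λf. phi (𝔟 f)] *)
Definition restrict_cantor G (phi : tm G ty2) : tm G ty2 :=
  lam (wk ty1 phi · (bb · v0)).

(** * Defined relations and quantifiers *)

Fixpoint Eq G s : tm G s -> tm G s -> fm G :=
  match s with
  | O => fun x y => Eq0 x y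
  | r ⇒ t => fun x y => All r (Eq (wk r x · v0) (wk r y · v0))
  end.

Definition Le0 G (x y : tm G O) : fm G :=
  Ex O (Eq0 (plus · wk O x · v0) (wk O y)).

(** Strong majorizability [x ≤* y]; in the arrow case [v1] is the outer
    variable [v] and [v0] is [u]. *)
Fixpoint Maj G s : tm G s -> tm G s -> fm G :=
  match s with
  | O => fun x y => Le0 x y
  | r ⇒ t => fun x y =>
      All r (All r (Maj v0 v1 ⊃
        Maj (wk r (wk r x) · v0) (wk r (wk r y) · v1) ∧∧
        Maj (wk r (wk r y) · v0) (wk r (wk r y) · v1)))
  end.

Definition AllSt G s (A : fm (s :: G)) : fm G := All s (St v0 ⊃ A).
Definition ExSt G s (A : fm (s :: G)) : fm G := Ex s (St v0 ∧∧ A).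

Definition AllMonSt G s (A : fm (s :: G)) : fm G :=
  AllSt (Maj v0 v0 ⊃ A).
Definition ExMonSt G s (A : fm (s :: G)) : fm G :=
  ExSt (Maj v0 v0 ∧∧ A).

(** [(∃ y ≤* b) A] *)
Definition ExBd G s (b : tm G s) (A : fm (s :: G)) : fm G :=
  Ex s (Maj v0 (wk s b) ∧∧ A).

(** A standard binary sequence is an [f] with [St f] and [Binary f]. *)
Definition Binary G (f : tm G ty1) : fm G := All O (Le0 (wk O f · v0) One).

(** * Theories, given by axiom schemata whose instances may contain parameters *)

Definition theory : Type := forall G : ctx, fm G -> Prop.

(** [A(n)] becomes [A(S n)], still in context [O :: G]. *)
Definition at_succ G (A : fm (O :: G)) : fm (O :: G) :=
  fsub (scons (Succ · v0) (@shift G O)) A.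

Inductive EPA : theory :=
| ax_refl : forall G (x : tm G O), EPA (Eq0 x x)
| ax_sym : forall G (x y : tm G O), EPA (Eq0 x y ⊃ Eq0 y x)
| ax_trans : forall G (x y z : tm G O),
    EPA (Eq0 x y ⊃ Eq0 y z ⊃ Eq0 x z)
| ax_ext : forall G r t (z : tm G (r ⇒ t)) (x y : tm G r),
    EPA (Eq x y ⊃ Eq (z · x) (z · y))
| ax_succ_neq0 : forall G (x : tm G O), EPA (Neg (Eq0 (Succ · x) Zero))
| ax_succ_inj : forall G (x y : tm G O),
    EPA (Eq0 (Succ · x) (Succ · y) ⊃ Eq0 x y)
| ax_Pi : forall G s t (x : tm G s) (y : tm G t), EPA (Eq (Pi · x · y) x)
| ax_Sigma : forall G r s t
    (x : tm G (r ⇒ s ⇒ t)) (y : tm G (r ⇒ s)) (z : tm G r),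
    EPA (Eq (Sigma · x · y · z) (x · z · (y · z)))
| ax_Rec0 : forall G s (y : tm G s) (z : tm G (s ⇒ O ⇒ s)),
    EPA (Eq (Rec · Zero · y · z) y)
| ax_RecS : forall G s (x : tm G O) (y : tm G s) (z : tm G (s ⇒ O ⇒ s)),
    EPA (Eq (Rec · (Succ · x) · y · z) (z · (Rec · x · y · z) · x))
| ax_ind : forall G (A : fm (O :: G)), internal A ->
    EPA (inst A Zero ∧∧ All O (A ⊃ at_succ A) ⊃ All O A).

Inductive EPAst : theory :=
| ax_EPA : forall G (A : fm G), EPA A -> EPAst A
| ax_st_eq : forall G s (x y : tm G s), EPAst (Eq x y ⊃ St x ⊃ St y)
| ax_st_maj : forall G s (x y : tm G s), EPAst (St y ⊃ Maj x y ⊃ St x)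
| ax_st_closed : forall G s (t : tm G s), closed t -> EPAst (St t)
| ax_st_app : forall G s t (z : tm G (s ⇒ t)) (x : tm G s),
    EPAst (St z ⊃ St x ⊃ St (z · x))
| ax_st_ind : forall G (A : fm (O :: G)),
    EPAst (inst A Zero ∧∧ AllSt (A ⊃ at_succ A) ⊃ AllSt A).

(** Renames [A(x, y)], with [x] = [v1] and [y] = [v0], so as to skip a variable
    bound outside [x] and [y]. *)
Definition skip G r s t (A : fm (t :: s :: G)) : fm (t :: s :: r :: G) :=
  fsub (up (up (@shift G r))) A.

Inductive M : theory :=
| ax_EPAst : forall G (A : fm G), EPAst A -> M A
| ax_mAC : forall G s t (A : fm (t :: s :: G)), internal A ->
    M (AllMonSt (ExMonSt A) ⊃
       ExMonSt (AllMonSt (ExBd (Var (vs vz) · v0) (skip (s ⇒ t) A))))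
| ax_R : forall G s t (A : fm (t :: s :: G)), internal A ->
    M (All s (ExSt A) ⊃ ExMonSt (All s (ExBd v1 (skip t A))))
| ax_MAJ : forall G s, M (@AllSt G s (@ExSt _ s (Maj v1 v0))).

(** * Classical natural deduction over a theory *)

Inductive prv (T : theory) (G : ctx) (H : list (fm G)) : fm G -> Prop :=
| p_hyp : forall A, In A H -> prv T H A
| p_ax : forall A, T G A -> prv T H A
| p_impI : forall A B, prv T (A :: H) B -> prv T H (A ⊃ B)
| p_impE : forall A B, prv T H (A ⊃ B) -> prv T H A -> prv T H B
| p_andI : forall A B, prv T H A -> prv T H B -> prv T H (A ∧∧ B)
| p_andE1 : forall A B, prv T H (A ∧∧ B) -> prv T H A
| p_andE2 : forall A B, prv T H (A ∧∧ B) -> prv T H B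
| p_orI1 : forall A B, prv T H A -> prv T H (Or A B)
| p_orI2 : forall A B, prv T H B -> prv T H (Or A B)
| p_orE : forall A B C, prv T H (Or A B) ->
    prv T (A :: H) C -> prv T (B :: H) C -> prv T H C
| p_raa : forall A, prv T (Neg A :: H) Bot -> prv T H A
| p_allI : forall s (A : fm (s :: G)),
    prv T (map (@fwk G s) H) A -> prv T H (All s A)
| p_allE : forall s (A : fm (s :: G)) (x : tm G s),
    prv T H (All s A) -> prv T H (inst A x)
| p_exI : forall s (A : fm (s :: G)) (x : tm G s),
    prv T H (inst A x) -> prv T H (Ex s A)
| p_exE : forall s (A : fm (s :: G)) (C : fm G), prv T H (Ex s A) ->
    prv T (A :: map (@fwk G s) H) (fwk s C) -> prv T H C.

Definition proves (T : theory) (A : fm []) : Prop := prv T [] A.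

(* Main.v *)
Require Import Defs.
From Stdlib Require Import List.
Import ListNotations.
Set Implicit Arguments.
Unset Strict Implicit.

(** The system [M] proves that a functional with values in type [O] is standard
    as soon as one standard number bounds all its values: it is then strongly
    majorized by a constant functional, which is standard, and standardness is
    inherited downwards along majorization ([st_of_bounded]).

    This is used twice. A binary sequence is bounded by [1], so it is standard.
    Every [𝔟 f] is binary, so the hypothesis on [φ] yields that [φ (𝔟 f)] is
    standard for all [f], whether or not [f] itself is standard. Realization
    then turns [∀ f, ∃ standard n, φ (𝔟 f) = n] into a single standard bound
    [N] on all the values [φ (𝔟 f)], and [st_of_bounded] applies a second time,
    now to [λ f. φ (𝔟 f)].

    The remaining work is equational: closed terms are given by bracket
    abstraction, so facts about [𝔟] and [plus] go through a provable
    [β]-equation ([beta]). *)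

(** * Substitution *)

Lemma tsub_tsub G D E (g : sub D E) (f : sub G D) s (t : tm G s) :
  tsub g (tsub f t) = tsub (fun r v => tsub g (f r v)) t.
Proof. induction t; simpl; congruence. Qed.

Lemma tsub_id G s (t : tm G s) : tsub (@idsub G) t = t.
Proof. induction t; simpl; unfold idsub in *; congruence. Qed.

Lemma tsub_up_wk G D (f : sub G D) r s (t : tm G s) :
  tsub (up (s := r) f) (wk r t) = wk r (tsub f t).
Proof. unfold wk. rewrite !tsub_tsub. reflexivity. Qed.

Lemma tsub_scons_wk G D (f : sub G D) r (a : tm D r) s (t : tm G s) :
  tsub (scons a f) (wk r t) = tsub f t.
Proof. unfold wk. rewrite tsub_tsub. reflexivity. Qed.

Lemma fsub_Eq G D (f : sub G D) s (x y : tm G s) :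
  fsub f (Eq x y) = Eq (tsub f x) (tsub f y).
Proof.
  revert G D f x y; induction s as [|r _ t IH]; intros; simpl; [reflexivity|].
  rewrite IH. simpl. now rewrite !tsub_up_wk.
Qed.

Lemma fsub_Le0 G D (f : sub G D) (x y : tm G O) :
  fsub f (Le0 x y) = Le0 (tsub f x) (tsub f y).
Proof.
  unfold Le0. cbn [fsub tsub]. rewrite !tsub_up_wk. reflexivity.
Qed.

Lemma inst_Eq_app G r t (x y : tm G (r ⇒ t)) (a : tm G r) :
  inst (Eq (wk r x · v0) (wk r y · v0)) a = Eq (x · a) (y · a).
Proof.
  unfold inst. rewrite fsub_Eq. cbn [tsub]. now rewrite !tsub_scons_wk, !tsub_id.
Qed.

Lemma var_case G s (P : forall t, var (s :: G) t -> Prop) :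
  P s vz -> (forall t (v : var G t), P t (vs v)) -> forall t v, P t v.
Proof.
  intros Hz Hs t v. revert P Hz Hs.
  refine (match v as v' in var G' t' return
    match G' return var G' t' -> Prop with
    | [] => fun _ => True
    | s' :: G0 => fun v' => forall P : forall t, var (s' :: G0) t -> Prop,
        P s' vz -> (forall t (w : var G0 t), P t (vs w)) -> P t' v'
    end v' with vz => _ | vs w => _ end); auto.
Qed.

(** * Equational reasoning inside the system *)

Lemma by_EPA G (H : list (fm G)) A : EPA A -> prv M H A.
Proof. intro h. apply p_ax, ax_EPAst, ax_EPA, h. Qed.

Lemma by_EPAst G (H : list (fm G)) A : EPAst A -> prv M H A.
Proof. intro h. apply p_ax, ax_EPAst, h. Qed.

Lemma Eq0_sym G (H : list (fm G)) x y :
  prv M H (Eq0 x y) -> prv M H (Eq0 y x).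
Proof. apply p_impE, by_EPA, ax_sym. Qed.

Lemma Eq_app1 G (H : list (fm G)) r t (x y : tm G (r ⇒ t)) a :
  prv M H (Eq x y) -> prv M H (Eq (x · a) (y · a)).
Proof. intro h. rewrite <- inst_Eq_app. now apply p_allE. Qed.

Lemma Eq_app2 G (H : list (fm G)) r t (z : tm G (r ⇒ t)) x y :
  prv M H (Eq x y) -> prv M H (Eq (z · x) (z · y)).
Proof. apply p_impE, by_EPA, ax_ext. Qed.

(** Stated as an implication inside the system because the induction on the type
    passes under a quantifier, where the hypotheses are weakened. *)
Lemma Eq_trans_imp G (H : list (fm G)) s (x y z : tm G s) :
  prv M H (Eq x y ⊃ Eq y z ⊃ Eq x z).
Proof.
  revert G H x y z; induction s as [|r _ t IH]; intros.
  - apply by_EPA, ax_trans.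
  - apply p_impI, p_impI, p_allI.
    apply p_impE with (A := Eq (wk r y · v0) (wk r z · v0));
      [apply p_impE with (A := Eq (wk r x · v0) (wk r y · v0)); [apply IH|] |];
      apply Eq_app1, p_hyp; unfold wk; rewrite <- fsub_Eq; simpl; auto.
Qed.

Lemma Eq_trans G (H : list (fm G)) s (x y z : tm G s) :
  prv M H (Eq x y) -> prv M H (Eq y z) -> prv M H (Eq x z).
Proof. intros h1 h2. eapply p_impE; [eapply p_impE; [apply Eq_trans_imp|]|]; eauto. Qed.

Lemma Eq_app G (H : list (fm G)) r t (x y : tm G (r ⇒ t)) a b :
  prv M H (Eq x y) -> prv M H (Eq a b) -> prv M H (Eq (x · a) (y · b)).
Proof.
  intros h1 h2. eapply Eq_trans; [now apply Eq_app1, h1 | now apply Eq_app2].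
Qed.

(** The environment [e] is what makes nested abstractions reducible: [lam] does
    not commute with substitution, so after one reduction an inner [lam] is of
    the form [tsub e (lam t)], not [lam (tsub (up e) t)]. *)
Lemma beta G D (H : list (fm D)) (e : sub G D) s t (x : tm (s :: G) t) a :
  prv M H (Eq (tsub e (lam x) · a) (tsub (scons a e) x)).
Proof.
  induction x as [t v|r t x IHx y IHy| | | | |];
    try (apply by_EPA, ax_Pi).
  - revert t v. apply var_case; intros; simpl.
    + eapply Eq_trans; apply by_EPA; [apply ax_Sigma | apply ax_Pi].
    + apply by_EPA, ax_Pi.
  - simpl. eapply Eq_trans; [apply by_EPA, ax_Sigma|]. now apply Eq_app.
Qed.

Lemma beta2 G D (H : list (fm D)) (e : sub G D) r s t
    (x : tm (s :: r :: G) t) a b :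
  prv M H (Eq (tsub e (lam (lam x)) · a · b) (tsub (scons b (scons a e)) x)).
Proof. eapply Eq_trans; [apply Eq_app1, beta | apply beta]. Qed.

(** * The order on numbers *)

Lemma plus_unfold G (H : list (fm G)) x y :
  prv M H (Eq0 (plus · x · y) (Rec · y · x · lam (lam (Succ · v1)))).
Proof.
  exact (beta2 H (@idsub G) (Rec · v0 · v1 · lam (lam (Succ · v1))) x y).
Qed.

Lemma plus_0 G (H : list (fm G)) x : prv M H (Eq0 (plus · x · Zero) x).
Proof.
  exact (Eq_trans (s := O) (plus_unfold H x Zero) (by_EPA H (ax_Rec0 _ _))).
Qed.

Lemma plus_S G (H : list (fm G)) x y :
  prv M H (Eq0 (plus · x · (Succ · y)) (Succ · (plus · x · y))).
Proof.
  apply (Eq_trans (s := O) (plus_unfold H x (Succ · y))).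
  apply (Eq_trans (s := O) (by_EPA H (ax_RecS (s := O) _ _ _))).
  apply (Eq_trans (s := O) (beta2 H (@idsub G) (Succ · v1) _ _)).
  apply (Eq_app2 (t := O) Succ (x := Rec · y · x · _)), Eq0_sym, plus_unfold.
Qed.

Lemma Le0_intro G (H : list (fm G)) x y z :
  prv M H (Eq0 (plus · x · z) y) -> prv M H (Le0 x y).
Proof.
  intro h. apply p_exI with (x := z). unfold inst. cbn [fsub tsub].
  rewrite !tsub_scons_wk, !tsub_id. exact h.
Qed.

Lemma Le0_refl G (H : list (fm G)) x : prv M H (Le0 x x).
Proof. apply Le0_intro with (z := Zero), plus_0. Qed.

Lemma Le0_0_1 G (H : list (fm G)) : prv M H (Le0 Zero One).
Proof.
  apply Le0_intro with (z := One).
  apply (Eq_trans (s := O) (plus_S H Zero Zero)).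
  apply (Eq_app2 (t := O) Succ (y := Zero)), plus_0.
Qed.

Lemma Le0_cong_imp G (H : list (fm G)) x x' y y' :
  prv M H (Eq0 x' x ⊃ Eq0 y y' ⊃ Le0 x y ⊃ Le0 x' y').
Proof.
  do 3 apply p_impI.
  eapply p_exE; [apply p_hyp; now left|].
  unfold fwk. rewrite fsub_Le0. apply Le0_intro with (z := v0).
  apply (Eq_trans (s := O) (y := plus · wk O x · v0)).
  - apply (Eq_app1 (t := O)), (Eq_app2 (r := O) plus), p_hyp.
    simpl; auto.
  - apply (Eq_trans (s := O) (y := wk O y)); apply p_hyp; simpl; auto.
Qed.

Lemma Le0_cong G (H : list (fm G)) x x' y y' :
  prv M H (Eq0 x' x) -> prv M H (Eq0 y y') -> prv M H (Le0 x y) ->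
  prv M H (Le0 x' y').
Proof.
  intros h1 h2. apply p_impE. eapply p_impE; [|exact h2].
  eapply p_impE; [apply Le0_cong_imp|exact h1].
Qed.

(** * Bounded functionals are standard *)

(** At [r = O] and [N = One] this is [Binary f]. *)
Definition Bounded G r (f : tm G (r ⇒ O)) (N : tm G O) : fm G :=
  All r (Le0 (wk r f · v0) (wk r N)).

Lemma fsub_Bounded G D (e : sub G D) r (f : tm G (r ⇒ O)) N :
  fsub e (Bounded f N) = Bounded (tsub e f) (tsub e N).
Proof.
  unfold Bounded. cbn [fsub]. rewrite fsub_Le0. cbn [tsub].
  rewrite !tsub_up_wk. reflexivity.
Qed.

Lemma Bounded_elim G (H : list (fm G)) r (f : tm G (r ⇒ O)) N a :
  prv M H (Bounded f N) -> prv M H (Le0 (f · a) N).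
Proof.
  intro h. apply p_allE with (x := a) in h. revert h.
  unfold inst. rewrite fsub_Le0. cbn [tsub].
  now rewrite !tsub_scons_wk, !tsub_id.
Qed.

(** The constant functional [Pi · N] majorizes [f]: a majorant need only bound
    the values, since a constant functional is trivially monotone. *)
Lemma Maj_const_of_bounded G (H : list (fm G)) r (f : tm G (r ⇒ O)) N :
  prv M H (Bounded f N ⊃ Maj f (Pi · N)).
Proof.
  apply p_impI. cbn [Maj]. apply p_allI, p_allI, p_impI, p_andI.
  - apply Le0_cong with (x := wk r (wk r f) · v0) (y := wk r (wk r N)).
    + apply by_EPA, ax_refl.
    + apply Eq0_sym, (by_EPA _ (ax_Pi (s := O) _ _)).
    + apply Bounded_elim, p_hyp. unfold wk. rewrite <- !fsub_Bounded.
      simpl. auto.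
  - apply Le0_cong with (x := wk r (wk r N)) (y := wk r (wk r N)).
    + apply (by_EPA _ (ax_Pi (s := O) _ _)).
    + apply Eq0_sym, (by_EPA _ (ax_Pi (s := O) _ _)).
    + apply Le0_refl.
Qed.

Lemma st_of_bounded G (H : list (fm G)) r (f : tm G (r ⇒ O)) N :
  prv M H (Bounded f N) -> prv M H (St N) -> prv M H (St f).
Proof.
  intros hb hN.
  eapply p_impE; [eapply p_impE; [apply by_EPAst, ax_st_maj with (y := Pi · N)|]|].
  - eapply p_impE; [eapply p_impE; [apply by_EPAst, ax_st_app|]|exact hN].
    apply by_EPAst, ax_st_closed. exact I.
  - eapply p_impE; [apply Maj_const_of_bounded | exact hb].
Qed.

(** * Cantor space *)

(** [Rec · n · Zero · lam (lam One)] is the sign of [n]; only the values at [0]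
    and at a successor matter, and induction serves as the case distinction. *)
Lemma sign_le_1 G (H : list (fm G)) n :
  prv M H (Le0 (Rec · n · Zero · lam (lam One)) One).
Proof.
  assert (h : prv M H (All O (Le0 (Rec · v0 · Zero · lam (lam One)) One))).
  { eapply p_impE; [apply by_EPA, ax_ind; simpl; auto|]. apply p_andI.
    - change (prv M H (Le0 (Rec · Zero · Zero · lam (lam One)) One)).
      eapply Le0_cong; [|apply by_EPA, ax_refl|apply Le0_0_1].
      apply (by_EPA _ (ax_Rec0 (s := O) _ _)).
    - apply p_allI, p_impI.
      match goal with |- prv M ?K _ => change (prv M K
        (Le0 (Rec · (Succ · v0) · Zero · lam (lam One)) One)) end.
      eapply Le0_cong; [|apply by_EPA, ax_refl|apply (Le0_refl _ One)].
      eapply (Eq_trans (s := O)); [apply (by_EPA _ (ax_RecS (s := O) _ _ _))|].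
      exact (beta2 _ (@idsub _) One _ _). }
  apply p_allE with (x := n) in h. exact h.
Qed.

Lemma Binary_bb G (H : list (fm G)) (f : tm G ty1) : prv M H (Binary (bb · f)).
Proof.
  apply p_allI.
  eapply Le0_cong; [|apply by_EPA, ax_refl|apply (sign_le_1 _ (wk O f · v0))].
  exact (beta2 _ (@idsub _)
    (Rec · (v1 · v0) · Zero · lam (lam One)) (wk O f) v0).
Qed.

Theorem theorem1p14 :
  proves M
    (All ty2
       (AllSt (s := ty1) (Binary v0 ⊃ St (v1 · v0))
        ⊃ St (restrict_cantor v0))).
Proof.
  apply p_allI, p_impI. cbn [map].
  set (K := [AllSt (s := ty1) (Binary v0 ⊃ St (v1 · v0))] : list (fm [ty2])).
  pose (A := Eq0 (v2 · (bb · v1)) v0 : fm [O; ty1; ty2]).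
  assert (pointwise : prv M K (All ty1 (ExSt A))).
  { apply p_allI, p_exI with (x := v1 · (bb · v0)), p_andI.
    - (* [𝔟 f] is standard even for nonstandard [f], being binary *)
      assert (h : prv M (map (@fwk [ty2] ty1) K)
                    (AllSt (s := ty1) (Binary v0 ⊃ St (v2 · v0)))).
      { apply p_hyp. now left. }
      apply p_allE with (x := bb · v0) in h.
      refine (p_impE (p_impE h _) (Binary_bb _ v0)).
      apply st_of_bounded with (N := One); [apply Binary_bb|].
      apply by_EPAst, ax_st_closed. simpl. auto.
    - apply by_EPA, ax_refl. }
  assert (uniform : prv M K (ExMonSt (All ty1 (ExBd v1 (skip O A))))).
  { eapply p_impE; [apply p_ax, ax_R; simpl; auto|exact pointwise]. }
  eapply p_exE; [exact uniform|].
  (* [v0] is now the standard bound [N], and [v1] is [φ] *)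
  change (fwk O (St (restrict_cantor v0))) with
    (St (restrict_cantor (v1 : tm [O; ty2] ty2))).
  apply st_of_bounded with (N := v0).
  2: { eapply p_andE1, p_hyp. now left. }
  apply p_allI.
  apply Le0_cong with (x := v2 · (bb · v0)) (y := v1).
  { exact (beta _ (@idsub _) (Var (vs (vs (vs vz))) · (bb · v0)) v0). }
  { apply by_EPA, ax_refl. }
  match goal with |- prv M ?L _ =>
    assert (h : prv M L (All ty1
      (ExBd v2 (Eq0 (Var (vs (vs (vs (vs vz)))) · (bb · v1)) v0)))) end.
  { eapply p_andE2, p_andE2, p_hyp. now left. }
  apply p_allE with (x := v0) in h.
  eapply p_exE; [exact h|].
  change (fwk O (Le0 (v2 · (bb · v0)) v1)) with
    (Le0 (Var (vs (vs (vs vz))) · (bb · v1)) (v2 : tm [O; ty1; O; ty2] O)).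
  eapply Le0_cong; [|apply by_EPA, ax_refl|].
  - eapply p_andE2, p_hyp. now left.
  - eapply p_andE1, p_hyp. now left.
Qed.
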